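(* Let $(B,\cdot,\circ)$ be a completely simple left semi-brace, and put $G=1_{\circ}B1_{\circ}$. Then there are sets $I,J$ such that, as multiplicative semigroups, $(B,\cdot)\cong\mathcal{M}(G,I,J,\mathcal{I}_{|J|,|I|})=\{(g,i,j)\mid g\in G,\ i\in I,\ j\in J\}$, where indices (both denoted $1$) are fixed in $I$ and $J$ so that $1_{\circ}$ corresponds to $(1,1,1)$. Furthermore, identifying $B$ with this matrix semigroup: (1) the first row $R=\{(g,1,j)\mid g\in G,\ j\in J\}$ is a left cancellative left subsemi-brace of $B$; (2) the first column $K=\{(g,k,1)\mid g\in G,\ k\in I\}$ is a right cancellative left subsemi-brace of $B$; (3) $(G,1,1)=\{(g,1,1)\mid g\in G\}$ is a left subsemi-brace of $B$; moreover, $(G,\cdot)$ is a group. If, furthermore, $G=\{1\}$, then both $R$ and $K$ are two-sided semi-braces.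
   Context: A left semi-brace is a set $B$ with two operations $\cdot$ and $\circ$ such that $(B,\cdot)$ is a semigroup, $(B,\circ)$ is a group, and $a\circ(bc)=(a\circ b)(a\circ(\overline{a}c))$ for all $a,b,c\in B$ (here $xy$ means $x\cdot y$ and $\overline{a}$ is the inverse of $a$ in $(B,\circ)$). The identity of $(B,\circ)$ is denoted $1_{\circ}$, and $1_{\circ}B1_{\circ}=\{1_{\circ}b1_{\circ}\mid b\in B\}$. A left semi-brace has a semigroup property (completely simple, left cancellative, right cancellative, ...) if $(B,\cdot)$ does. A left subsemi-brace is a subset that is a subsemigroup of $(B,\cdot)$ and a subgroup of $(B,\circ)$. A two-sided semi-brace is a left semi-brace that is also a right semi-brace, i.e. also satisfies $(bc)\circ a=((b\overline{a})\circ a)(c\circ a)$ for all $a,b,c$. $\mathcal{I}_{|J|,|I|}$ is the $J\times I$ matrix all of whose entries are the identity $1$ of $G$; thus multiplication in $\mathcal{M}(G,I,J,\mathcal{I}_{|J|,|I|})$ is $(g,i,j)(h,k,l)=(gh,i,l)$. *)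

(* Defs.v *)
From HB Require Import structures.
From mathcomp Require Import all_boot.
From mathcomp Require Import boolp classical_sets functions.

Set Implicit Arguments.
Unset Strict Implicit.
Unset Printing Implicit Defensive.

Local Open Scope group_scope.
Local Open Scope classical_set_scope.

(* The library group structure on the carrier (operation *, unit 1, inverse
   x^-1) is (B, ∘); the additional operation dot is the semigroup (B, ⋅). *)
HB.mixin Record Group_isLeftSemiBrace B of Group B := {
  dot : B -> B -> B;
  dotA : associative dot;
  left_semi_brace_axiom : forall a b c : B,
    (a * dot b c = dot (a * b) (a * dot a^-1 c))%g
}.

#[short(type="leftSemiBraceType")]
HB.structure Definition LeftSemiBrace :=
  {B of Group B & Group_isLeftSemiBrace B}.

Declare Scope semi_brace_scope.
Delimit Scope semi_brace_scope with sb.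
Notation "a ⋅ b" := (dot a b) (at level 40, left associativity)
  : semi_brace_scope.
Notation "a ∘ b" := (@mul _ a b) (at level 40, left associativity)
  : semi_brace_scope.
Local Open Scope semi_brace_scope.

Section Semigroups.
Variables (T : Type) (op : T -> T -> T).

Definition two_sided_ideal (A : set T) : Prop :=
  A !=set0 /\ forall a x, A a -> A (op a x) /\ A (op x a).

Definition simple_semigroup : Prop :=
  forall A : set T, two_sided_ideal A -> A = setT.

Definition idempotent_elt (e : T) : Prop := op e e = e.

Definition primitive_idempotent (e : T) : Prop :=
  idempotent_elt e /\
  forall f, idempotent_elt f -> op e f = f -> op f e = f -> f = e.

Definition completely_simple : Prop :=
  simple_semigroup /\ exists e, primitive_idempotent e.

Definition left_cancellative (A : set T) : Prop :=
  forall a b c, A a -> A b -> A c -> op a b = op a c -> b = c.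

Definition right_cancellative (A : set T) : Prop :=
  forall a b c, A a -> A b -> A c -> op b a = op c a -> b = c.

Definition op_closed (A : set T) : Prop :=
  forall a b, A a -> A b -> A (op a b).

Definition is_group (A : set T) (e : T) : Prop :=
  [/\ op_closed A,
      forall a b c, A a -> A b -> A c -> op a (op b c) = op (op a b) c,
      A e,
      forall a, A a -> op e a = a /\ op a e = a &
      forall a, A a -> exists2 b, A b & op a b = e /\ op b a = e].

(* M(G, I, J, P), for G a subset of T: its elements are the triples in
   rees_set G I J, and P is a J x I matrix. *)
Definition rees_set (G : set T) (I J : Type) : set (T * I * J) :=
  [set x | G x.1.1].

Definition rees_mul (I J : Type) (P : J -> I -> T) (x y : T * I * J) :
    T * I * J :=
  (op (op x.1.1 (P x.2 y.1.2)) y.1.1, x.1.2, y.2).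

End Semigroups.

Arguments rees_set {T} G I J.

Definition semigroup_iso (S T : Type) (A : set S) (opS : S -> S -> S)
    (C : set T) (opT : T -> T -> T) (f : S -> T) : Prop :=
  set_bij A C f /\ forall x y, A x -> A y -> f (opS x y) = opT (f x) (f y).

Section SemiBraces.
Variable B : leftSemiBraceType.

Definition unit_core : set B := [set 1 ⋅ b ⋅ 1 | b in [set: B]].

Definition left_subsemibrace (A : set B) : Prop :=
  op_closed dot A /\ group_closed (mem A).

Definition two_sided_semibrace (A : set B) : Prop :=
  left_subsemibrace A /\
  forall a b c, A a -> A b -> A c ->
    (b ⋅ c) ∘ a = ((b ⋅ a^-1%g) ∘ a) ⋅ (c ∘ a).

Definition ones_matrix (I J : Type) : J -> I -> B := fun _ _ => 1.

End SemiBraces.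

Arguments unit_core B : clear implicits.
Arguments ones_matrix B I J : clear implicits.

(* Main.v *)
Require Import Defs.
From HB Require Import structures.
From mathcomp Require Import all_boot.
From mathcomp Require Import boolp classical_sets functions.

(** Taking a = 1 in the semi-brace axiom gives b ⋅ c = b ⋅ 1 ⋅ c: the group
    identity 1 is a middle identity of (B, ⋅).  In a completely simple
    semigroup this forces e = 1 to be a primitive idempotent
    ([middle_identity_primitive]), so the local submonoid eBe is a group
    ([primitive_local_inverse]).  If b' denotes the inverse of ebe in eBe, then
    b = b b' b ([middle_identity_regular]), and b is recovered as i g j from
    its core g = ebe, its left part i = b b' and its right part j = b' b.  A
    middle identity makes cores multiply freely, while a product keeps the left
    part of its first factor and the right part of its last one; this is the
    multiplication of the Rees matrix semigroup over a matrix of ones, with the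
    possible left and right parts as index sets.

    The first row is { b | e b = b } and the first column { b | b e = b }.
    Their stability under the group operation comes from
    a ∘ (b ⋅ c) = (a ∘ b) ⋅ (a ∘ (a^-1 ⋅ c)): when a ∘ b is exhibited as a
    ⋅-product, the left part (or the right part) of one factor is already known
    and passes to the product.  When the core is trivial, row and column are a
    right zero and a left zero band, for which the right semi-brace axiom is
    immediate. *)

Local Open Scope group_scope.
Local Open Scope classical_set_scope.
Local Open Scope semi_brace_scope.

Set Implicit Arguments.
Unset Strict Implicit.

(** * Completely simple semigroups with a middle identity *)

Definition middle_identity (T : Type) (op : T -> T -> T) (e : T) : Prop :=
  forall x y, op (op x e) y = op x y.

Section CompletelySimple.
Variables (T : Type) (op : T -> T -> T).
Hypothesis opA : associative op.
Hypothesis simple : simple_semigroup op.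
Local Notation "x ⋆ y" := (op x y) (at level 40, left associativity).

Lemma simple_factor a b : exists x y, b = x ⋆ a ⋆ y.
Proof.
have : two_sided_ideal op [set z | exists x y, z = x ⋆ a ⋆ y].
  split; first by exists (a ⋆ a ⋆ a), a, a.
  move=> _ z [x [y ->]]; split.
    by exists x, (y ⋆ z); rewrite !opA.
  by exists (z ⋆ x), y; rewrite !opA.
by move=> /simple /seteqP[_ /(_ b I)].
Qed.

(** Writing f = x a y with x, y in fTf, both a y x and y x a are idempotents
    below f, hence equal to f: so y x is a two-sided inverse of a. *)
Lemma primitive_local_inverse f : primitive_idempotent op f ->
  forall a, f ⋆ a = a -> a ⋆ f = a ->
  exists b, [/\ f ⋆ b = b, b ⋆ f = b, a ⋆ b = f & b ⋆ a = f].
Proof.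
move=> [ff fmin] a fa af; have {}ff : f ⋆ f = f by [].
have [x0 [y0 f_eq]] := simple_factor a f.
pose x := f ⋆ x0 ⋆ f; pose y := f ⋆ y0 ⋆ f.
have fx : f ⋆ x = x by rewrite /x !opA ff.
have xf : x ⋆ f = x by rewrite /x -opA ff.
have fy : f ⋆ y = y by rewrite /y !opA ff.
have yf : y ⋆ f = y by rewrite /y -opA ff.
have xay : x ⋆ a ⋆ y = f.
  rewrite /x /y -(opA _ f a) fa !opA -(opA _ a f) af.
  by rewrite -(opA f x0) -(opA f) -f_eq !ff.
clearbody x y; exists (y ⋆ x); split.
- by rewrite opA fy.
- by rewrite -opA xf.
- rewrite opA; apply: fmin; last by rewrite -opA xf.
    rewrite /idempotent_elt !opA -(opA _ x a) -(opA _ (x ⋆ a) y) xay.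
    by rewrite -(opA _ y f) yf.
  by rewrite !opA fa.
- apply: fmin; last by rewrite -opA af.
    rewrite /idempotent_elt !opA -(opA y x a) -(opA y (x ⋆ a) y) xay.
    by rewrite -(opA y f x) fx.
  by rewrite !opA fy.
Qed.

(** Write e = x f y with f a primitive idempotent.  The middle identity makes
    f y x f an idempotent below f, hence equal to f, so that e is conjugate to
    f through x f and f y; idempotency and primitivity are transported. *)
Lemma middle_identity_primitive f e : primitive_idempotent op f ->
  middle_identity op e -> primitive_idempotent op e.
Proof.
move=> [ff fmin] emid; have {}ff : f ⋆ f = f by [].
have [x [y e_eq]] := simple_factor f e.
have fyxf : f ⋆ y ⋆ x ⋆ f = f.
  apply: fmin; [|by rewrite !opA ff|by rewrite -opA ff].
  rewrite /idempotent_elt !opA -(opA _ f f) ff.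
  by rewrite -(opA (f ⋆ y) x f) -(opA (f ⋆ y) (x ⋆ f) y) -e_eq emid.
have ee : e ⋆ e = e.
  rewrite {1 2}e_eq !opA -(opA x f y) -(opA x (f ⋆ y) x).
  by rewrite -(opA x (f ⋆ y ⋆ x) f) fyxf -e_eq.
split=> // h hh eh he; have {}hh : h ⋆ h = h by [].
have fyhxf : f ⋆ y ⋆ h ⋆ x ⋆ f = f.
  apply: fmin; [|by rewrite !opA ff|by rewrite -opA ff].
  rewrite /idempotent_elt !opA -(opA _ f f) ff.
  rewrite -(opA (f ⋆ y ⋆ h) x f) -(opA (f ⋆ y ⋆ h) (x ⋆ f) y) -e_eq.
  rewrite -(opA _ h e) he.
  by rewrite -(opA _ h h) hh.
have -> : h = x ⋆ (f ⋆ y ⋆ h ⋆ x ⋆ f) ⋆ y.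
  by rewrite !opA -e_eq eh -(opA h x) -(opA h) -e_eq he.
by rewrite fyhxf -e_eq.
Qed.

(** Factor b = x e y.  If u and v are the local inverses of exe and eye, then
    ebe = (exe)(eye) forces b' = v u, and b b' b = x (y v) (u x) y collapses to
    x e y = b once factors e are inserted. *)
Lemma middle_identity_regular e b b' : primitive_idempotent op e ->
  middle_identity op e ->
  e ⋆ b' = b' -> b' ⋆ e = b' -> e ⋆ b ⋆ b' = e -> b ⋆ b' ⋆ b = b.
Proof.
move=> eprim emid eb' b'e ebb'.
have ee : e ⋆ e = e by case: eprim.
have [x [y]] := simple_factor e b; rewrite emid => b_eq.
have [||u [eu ue exu uxe]] := @primitive_local_inverse e eprim (e ⋆ x ⋆ e).
- by rewrite !opA ee.
- by rewrite -opA ee.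
have [||v [ev ve eyv vye]] := @primitive_local_inverse e eprim (e ⋆ y ⋆ e).
- by rewrite !opA ee.
- by rewrite -opA ee.
have yv : e ⋆ y ⋆ v = e by rewrite -{2}eyv emid.
have ux : u ⋆ x ⋆ e = e by rewrite -{2}uxe !opA ue.
have b'_eq : b' = v ⋆ u.
  have -> : b' = v ⋆ (u ⋆ (e ⋆ b ⋆ b')); last by rewrite ebb' ue.
  rewrite b_eq !opA emid -(opA _ u x) -(emid (v ⋆ (u ⋆ x))).
  by rewrite -(opA v) ux -(opA v e) -(emid _ b') -(opA v) vye eb'.
rewrite b'_eq {1}b_eq !opA -(emid x) -(opA x) -(opA x) yv -(opA x e u) eu.
by rewrite b_eq opA -(emid _ y) -(opA _ u x) -(opA x) ux emid.
Qed.

End CompletelySimple.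

(** * The Rees coordinates of a rectangular group *)

(** The map [inv] sends b to the inverse of e b e in the local group at e; the
    laws hold for every b thanks to the middle identity. *)
Section RectangularGroup.
Variables (T : Type) (op : T -> T -> T) (e : T) (inv : T -> T).
Local Notation "x ⋆ y" := (op x y) (at level 40, left associativity).
Hypothesis opA : associative op.
Hypothesis ee : e ⋆ e = e.
Hypothesis emid : middle_identity op e.
Hypothesis e_inv : forall b, e ⋆ inv b = inv b.
Hypothesis inv_e : forall b, inv b ⋆ e = inv b.
Hypothesis core_inv : forall b, e ⋆ b ⋆ inv b = e.
Hypothesis inv_core : forall b, inv b ⋆ b ⋆ e = e.
Hypothesis regular : forall b, b ⋆ inv b ⋆ b = b.

Definition core b := e ⋆ b ⋆ e.
Definition lpart b := b ⋆ inv b.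
Definition rpart b := inv b ⋆ b.

Lemma lpart_e b : lpart b ⋆ e = lpart b.
Proof. by rewrite /lpart -opA inv_e. Qed.

Lemma e_lpart b : e ⋆ lpart b = e.
Proof. by rewrite /lpart opA core_inv. Qed.

Lemma e_rpart b : e ⋆ rpart b = rpart b.
Proof. by rewrite /rpart opA e_inv. Qed.

Lemma rpart_e b : rpart b ⋆ e = e.
Proof. exact: inv_core. Qed.

Lemma lpart_mul b : lpart b ⋆ b = b.
Proof. exact: regular. Qed.

Lemma mul_rpart b : b ⋆ rpart b = b.
Proof. by rewrite /rpart opA regular. Qed.

Lemma lpart_unique i b : i ⋆ e = i -> i ⋆ b = b -> lpart b = i.
Proof.
by move=> ie ib; rewrite /lpart -{1}ib -(emid i b) -!opA (opA e) core_inv.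
Qed.

Lemma rpart_unique j b : e ⋆ j = j -> b ⋆ j = b -> rpart b = j.
Proof.
by move=> ej bj; rewrite /rpart -{2}bj -(emid b j) !opA inv_core.
Qed.

Lemma lpartM a b : lpart (a ⋆ b) = lpart a.
Proof. by apply: lpart_unique; rewrite ?lpart_e // opA lpart_mul. Qed.

Lemma rpartM a b : rpart (a ⋆ b) = rpart b.
Proof. by apply: rpart_unique; rewrite ?e_rpart // -opA mul_rpart. Qed.

Lemma coreM a b : core (a ⋆ b) = core a ⋆ core b.
Proof. by rewrite /core !opA !emid. Qed.

Lemma lpart_core_rpart b : lpart b ⋆ core b ⋆ rpart b = b.
Proof. by rewrite /lpart /core /rpart !opA !emid !regular. Qed.

Lemma core_id : core e = e.
Proof. by rewrite /core !ee. Qed.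

(** Having the left part of e, which is how the first row is given in Rees
    coordinates, thus becomes an equation that the group operation can use. *)
Lemma lpart_idP b : lpart b = e <-> e ⋆ b = b.
Proof. by split=> [<-|eb]; [exact: lpart_mul | exact: lpart_unique]. Qed.

Lemma rpart_idP b : rpart b = e <-> b ⋆ e = b.
Proof. by split=> [<-|be]; [exact: mul_rpart | exact: rpart_unique]. Qed.

Lemma mul_cancel_l a b c : a ⋆ b = a ⋆ c -> e ⋆ b = e ⋆ c.
Proof.
move=> abc; rewrite -(inv_core a) -!(opA _ e).
by rewrite !(opA _ e) !emid -!opA abc.
Qed.

Lemma mul_cancel_r a b c : b ⋆ a = c ⋆ a -> b ⋆ e = c ⋆ e.
Proof.
by move=> bac; rewrite -(core_inv a) !opA !emid bac.
Qed.

Definition lindex := {i : T | i ⋆ e = i /\ e ⋆ i = e}.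
Definition rindex := {j : T | e ⋆ j = j /\ j ⋆ e = e}.

Definition lindex_of b : lindex := exist _ _ (conj (lpart_e b) (e_lpart b)).
Definition rindex_of b : rindex := exist _ _ (conj (e_rpart b) (rpart_e b)).

Definition rees_coord b : T * lindex * rindex :=
  (core b, lindex_of b, rindex_of b).

Lemma lindex_of_inj b c : lindex_of b = lindex_of c <-> lpart b = lpart c.
Proof.
by split=> [/(congr1 (@sval _ _))//|bc]; apply: eq_exist.
Qed.

Lemma rindex_of_inj b c : rindex_of b = rindex_of c <-> rpart b = rpart c.
Proof.
by split=> [/(congr1 (@sval _ _))//|bc]; apply: eq_exist.
Qed.

(** The inverse map sends (g, i, j) to i g j. *)
Lemma rees_coord_bij :
  set_bij [set: T] (rees_set [set e ⋆ b ⋆ e | b in [set: T]] lindex rindex)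
    rees_coord.
Proof.
split=> [b _|b c _ _ [bc_core bc_l bc_r]|].
- by exists b.
- by rewrite -(lpart_core_rpart b) bc_core bc_l bc_r lpart_core_rpart.
move=> [[_ [i [ie ei]]] [j [ej je]]] [x _ /= <-].
have ii : i ⋆ i = i by rewrite -emid -opA ei.
have jj : j ⋆ j = j by rewrite -emid je.
have lE : lpart (i ⋆ core x ⋆ j) = i.
  by apply: lpart_unique => //; rewrite !opA ii.
have rE : rpart (i ⋆ core x ⋆ j) = j.
  by apply: rpart_unique => //; rewrite -opA jj.
exists (i ⋆ core x ⋆ j) => //; rewrite /rees_coord; congr (_, _, _).
- by rewrite /core !opA ei -(opA _ j e) je -opA ee.
- exact: eq_exist.
- exact: eq_exist.
Qed.

(** The entries of the matrix of ones are the middle identity e. *)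
Lemma rees_coordM b c : rees_coord (b ⋆ c) =
  rees_mul op (fun (_ : rindex) (_ : lindex) => e)
    (rees_coord b) (rees_coord c).
Proof.
rewrite /rees_coord /rees_mul /= emid -coreM; congr (_, _, _).
  by apply/lindex_of_inj; exact: lpartM.
by apply/rindex_of_inj; exact: rpartM.
Qed.

End RectangularGroup.

(** * First row and first column of a left semi-brace *)

Lemma one_middle_identity (B : leftSemiBraceType) :
  middle_identity (@dot B) (1 : B).
Proof.
by move=> b c; have := left_semi_brace_axiom 1 b c; rewrite invg1 !mul1g dotA.
Qed.

Lemma mul_lambda {B : leftSemiBraceType} (a b c : B) :
  a ∘ (b ⋅ c) = (a ∘ b) ⋅ (a ∘ (a^-1 ⋅ c)).
Proof. exact: left_semi_brace_axiom. Qed.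

Section RowColumn.
Variables (B : leftSemiBraceType) (inv : B -> B).
Hypothesis idem1 : (1 : B) ⋅ 1 = 1.
Hypothesis one_inv : forall b : B, 1 ⋅ inv b = inv b.
Hypothesis inv_one : forall b : B, inv b ⋅ 1 = inv b.
Hypothesis core_inv : forall b : B, 1 ⋅ b ⋅ inv b = 1.
Hypothesis inv_core : forall b : B, inv b ⋅ b ⋅ 1 = 1.
Hypothesis regular : forall b : B, b ⋅ inv b ⋅ b = b.

Let emid := @one_middle_identity B.
Let lid b := lpart_idP (@dotA B) idem1 emid core_inv regular b.
Let rid b := rpart_idP (@dotA B) idem1 emid inv_core regular b.
Let lM := lpartM (@dotA B) emid inv_one core_inv regular.
Let rM := rpartM (@dotA B) emid one_inv inv_core regular.

Definition row : set B := [set b | 1 ⋅ b = b].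
Definition column : set B := [set b | b ⋅ 1 = b].

Lemma group_closedP (A : set B) : A 1 ->
  (forall a b, A a -> A b -> A (a ∘ b)) -> (forall a, A a -> A a^-1) ->
  group_closed (mem A).
Proof.
move=> A1 AM AV; split; first by rewrite inE.
by move=> a b; rewrite !inE => Aa Ab; apply: AM => //; exact: AV.
Qed.

(** Applying a to b = 1 ⋅ b exhibits a ∘ b as a ⋅-product with first factor a,
    which is fixed by left translation by 1. *)
Lemma rowM a b : row a -> row b -> row (a ∘ b).
Proof.
rewrite /row /= => ra rb.
have -> : a ∘ b = a ⋅ (a ∘ (a^-1 ⋅ b)) by rewrite -{1}rb mul_lambda mulg1.
by rewrite dotA ra.
Qed.

(** For a in the row, 1 = a^-1 ∘ (1 ⋅ a) is a ⋅-product with first factor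
    a^-1, so a^-1 has the same left part as 1. *)
Lemma rowV a : row a -> row a^-1.
Proof.
rewrite /row /= => ra.
have := mul_lambda a^-1 1 a; rewrite ra mulVg mulg1 => one_eq.
have l1 : lpart (@dot B) inv 1 = 1 by apply/lid.
by apply/lid; rewrite -(lM _ (a^-1 ∘ (a^-1^-1 ⋅ a))) -one_eq.
Qed.

(** Both a = a ∘ (1 ⋅ 1) and a ∘ b = a ∘ (b ⋅ 1) end in the same factor
    a ∘ (a^-1 ⋅ 1), so a and a ∘ b have the same right part. *)
Lemma columnM a b : column a -> column b -> column (a ∘ b).
Proof.
rewrite /column /= => ca cb.
have := mul_lambda a 1 1; rewrite idem1 mulg1 => a_eq.
have := mul_lambda a b 1; rewrite cb => ab_eq.
by apply/rid; rewrite ab_eq rM -(rM a) -a_eq; apply/rid.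
Qed.

Lemma columnV a : column a -> column a^-1.
Proof.
rewrite /column /= => ca.
by have := mul_lambda a^-1 1 1; rewrite idem1 invgK ca mulVg mulg1.
Qed.

Lemma row_subsemibrace : left_subsemibrace row.
Proof.
split; first by move=> a b ra rb; rewrite /row /= dotA ra.
exact: (group_closedP idem1 rowM rowV).
Qed.

Lemma column_subsemibrace : left_subsemibrace column.
Proof.
split; first by move=> a b ca cb; rewrite /column /= -dotA cb.
exact: (group_closedP idem1 columnM columnV).
Qed.

Lemma subsemibraceI (A C : set B) : left_subsemibrace A ->
  left_subsemibrace C -> left_subsemibrace (A `&` C).
Proof.
move=> [Adot [A1 Adiv]] [Cdot [C1 Cdiv]]; split.
  by move=> a b [Aa Ca] [Ab Cb]; split; [exact: Adot | exact: Cdot].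
split; first by move: A1 C1; rewrite !inE.
move=> a b; rewrite !inE => -[Aa Ca] [Ab Cb].
have := Adiv a b; have := Cdiv a b; rewrite !inE => Cab Aab.
by split; [exact: Aab | exact: Cab].
Qed.

Lemma row_left_cancellative : left_cancellative (@dot B) row.
Proof.
move=> a b c _ rb rc /(mul_cancel_l (@dotA B) emid inv_core).
by rewrite rb rc.
Qed.

Lemma column_right_cancellative : right_cancellative (@dot B) column.
Proof.
move=> a b c _ cb cc /(mul_cancel_r (@dotA B) emid core_inv).
by rewrite cb cc.
Qed.

Hypothesis core1 : unit_core B = [set 1].

Lemma trivial_core (b : B) : 1 ⋅ b ⋅ 1 = 1.
Proof.
have : unit_core B (1 ⋅ b ⋅ 1) by exists b.
by rewrite core1.
Qed.

(** The row is a right zero band, and both sides of the right semi-brace axiom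
    reduce to c ∘ a. *)
Lemma row_two_sided : two_sided_semibrace row.
Proof.
have row0 b c : row b -> row c -> b ⋅ c = c.
  by move=> rb rc; rewrite -emid -rb trivial_core rc.
split=> [|a b c ra rb rc]; first exact: row_subsemibrace.
have rV := rowV ra.
by rewrite (row0 b c) // (row0 b) // mulVg (rowM rc ra).
Qed.

(** The column is a left zero band, and both sides of the right semi-brace
    axiom reduce to b ∘ a. *)
Lemma column_two_sided : two_sided_semibrace column.
Proof.
have col0 b c : column b -> column c -> b ⋅ c = b.
  by move=> cb cc; rewrite -emid -cc -dotA (dotA 1) trivial_core cb.
split=> [|a b c ca cb cc]; first exact: column_subsemibrace.
have cV := columnV ca.
by rewrite (col0 b c) // (col0 b) // (col0 (b ∘ a)) //; exact: columnM.
Qed.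

End RowColumn.

Unset Implicit Arguments.
Set Strict Implicit.

Theorem corollary2p9 (B : leftSemiBraceType)
    (hB : completely_simple (@dot B)) :
  let G := unit_core B in
  exists (I J : Type) (i1 : I) (j1 : J) (phi : B -> B * I * J),
    let R := phi @^-1` [set (g, i1, j) | g in G & j in [set: J]] in
    let K := phi @^-1` [set (g, k, j1) | g in G & k in [set: I]] in
    let G11 := phi @^-1` [set (g, i1, j1) | g in G] in
    [/\ semigroup_iso [set: B] (@dot B)
          (rees_set G I J) (rees_mul (@dot B) (ones_matrix B I J)) phi
        /\ phi 1 = (1, i1, j1),
        left_subsemibrace R /\ left_cancellative (@dot B) R,
        left_subsemibrace K /\ right_cancellative (@dot B) K,
        left_subsemibrace G11 /\ is_group (@dot B) G 1 &
        (G = [set 1] -> two_sided_semibrace R /\ two_sided_semibrace K)].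
Proof.
have [simple [f fprim]] := hB.
have emid := @one_middle_identity B.
have eprim := middle_identity_primitive (@dotA B) simple fprim emid.
have ee : (1 : B) ⋅ 1 = 1 by case: eprim.
have core_l (b : B) : 1 ⋅ (1 ⋅ b ⋅ 1) = 1 ⋅ b ⋅ 1 by rewrite !dotA ee.
have core_r (b : B) : 1 ⋅ b ⋅ 1 ⋅ 1 = 1 ⋅ b ⋅ 1 by rewrite -dotA ee.
have := choice (fun b : B => primitive_local_inverse (@dotA B) simple
  eprim (core_l b) (core_r b)).
move=> [inv invP].
have e_inv (b : B) : 1 ⋅ inv b = inv b by case: (invP b).
have inv_e (b : B) : inv b ⋅ 1 = inv b by case: (invP b).
have core_inv (b : B) : 1 ⋅ b ⋅ inv b = 1.
  by case: (invP b) => _ _ + _; rewrite emid.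
have inv_core (b : B) : inv b ⋅ b ⋅ 1 = 1.
  by case: (invP b) => _ _ _; rewrite !dotA inv_e.
have regular (b : B) : b ⋅ inv b ⋅ b = b.
  by apply: (middle_identity_regular (@dotA B) simple eprim).
pose phi := rees_coord (@dotA B) e_inv inv_e core_inv inv_core.
pose lidx := lindex_of (@dotA B) inv_e core_inv.
pose ridx := rindex_of (@dotA B) e_inv inv_core.
have coreG (b : B) : unit_core B (core (@dot B) 1 b) by exists b.
have lE b : lidx b = lidx 1 <-> 1 ⋅ b = b.
  rewrite -(lpart_idP (@dotA B) ee emid core_inv regular).
  rewrite lindex_of_inj (_ : lpart dot inv 1 = 1) //.
  exact/(lpart_idP (@dotA B) ee emid core_inv regular).
have rE b : ridx b = ridx 1 <-> b ⋅ 1 = b.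
  rewrite -(rpart_idP (@dotA B) ee emid inv_core regular).
  rewrite rindex_of_inj (_ : rpart dot inv 1 = 1) //.
  exact/(rpart_idP (@dotA B) ee emid inv_core regular).
exists _, _, (lidx 1), (ridx 1), phi.
set R := _ @^-1` _; set K := _ @^-1` _; set G11 := _ @^-1` _.
have -> : R = @row B.
  apply/seteqP; split=> b.
    move=> [g _ [j _ gb]].
    by apply/lE/esym; exact: (congr1 (fun x => x.1.2) gb).
  by move=> /lE lb; exists (core dot 1 b) => //;
    exists (ridx b) => //; rewrite -lb.
have -> : K = @column B.
  apply/seteqP; split=> b.
    move=> [g _ [i _ gb]].
    by apply/rE/esym; exact: (congr1 snd gb).
  by move=> /rE rb; exists (core dot 1 b) => //;
    exists (lidx b) => //; rewrite -rb.
have -> : G11 = @row B `&` @column B.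
  apply/seteqP; split=> b.
    move=> [g _ gb]; split.
      by apply/lE/esym; exact: (congr1 (fun x => x.1.2) gb).
    by apply/rE/esym; exact: (congr1 snd gb).
  by move=> [/lE lb /rE rb]; exists (core dot 1 b) => //; rewrite -{1}lb -rb.
have Rsub : left_subsemibrace (@row B) by exact: row_subsemibrace.
have Ksub : left_subsemibrace (@column B) by exact: column_subsemibrace.
split.
- split; last by congr (_, _, _); exact: core_id.
  split; first exact: rees_coord_bij.
  by move=> b c _ _; exact: rees_coordM.
- by split=> //; exact: row_left_cancellative.
- by split=> //; exact: column_right_cancellative.
- split; first exact: subsemibraceI.
  split.
  + by move=> _ _ [b _ <-] [c _ <-]; exists (b ⋅ c); rewrite // !dotA !emid.
  + by move=> a b c _ _ _; rewrite dotA.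
  + by exists 1; rewrite // !ee.
  + by move=> _ [b _ <-].
  + move=> _ [b _ <-]; exists (inv b).
      by exists (inv b); rewrite // e_inv inv_e.
    by case: (invP b).
- by move=> G1; split; [exact: row_two_sided | exact: column_two_sided].
Qed.
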